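(* Let $C_1,C_2,C_3,E,F$ be finite-dimensional quantum systems and $C=C_1C_2C_3$. For any density operators $\omega_{CF}$ on $CF$ and $\psi_{CE}$ on $CE$, there exists a unitary operator $U$ on $C$ such that both $$\big\|\mathrm{Tr}_{C_2C_3}[U\cdot\omega_{CF}]-\pi_{C_1}\otimes\omega_F\big\|_1^2\le 2\alpha$$ and $$\big\|\mathrm{Tr}_{C_1C_3}[U\cdot\psi_{CE}]-\pi_{C_2}\otimes\psi_E\big\|_1^2\le 2\beta,$$ where $$\alpha=\frac{d_C\,d_F\,\mathrm{Tr}\big[(\omega_{CF})^2\big]}{d_{C_2C_3}^2},\qquad \beta=\frac{d_C\,d_E\,\mathrm{Tr}\big[(\psi_{CE})^2\big]}{d_{C_1C_3}^2}.$$
   Context: All systems are finite-dimensional complex Hilbert spaces; juxtaposition of systems denotes tensor product, and $d_X$ is the dimension of $X$ (so $d_{XY}=d_Xd_Y$). $\pi_{C_1}$ and $\pi_{C_2}$ are the maximally mixed states $I/d_{C_1}$ and $I/d_{C_2}$. $\omega_F=\mathrm{Tr}_C\,\omega_{CF}$ and $\psi_E=\mathrm{Tr}_C\,\psi_{CE}$ are reduced states. $U\cdot\rho=U\rho U^{-1}$, with $U$ acting as the identity on systems other than $C$. The trace norm is $\|\rho\|_1=\mathrm{Tr}\sqrt{\rho^\dagger\rho}$. *)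

(* Defs.v *)
From mathcomp Require Export all_boot all_order all_algebra.
From mathcomp Require Export complex mxtens.
From mathcomp Require Export reals.

Set Implicit Arguments.
Unset Strict Implicit.
Unset Printing Implicit Defensive.

Import Order.TTheory GRing.Theory Num.Theory.
Local Open Scope ring_scope.
Local Open Scope sesquilinear_scope.

(* A system of dimension n is C^n, its operators are the matrices 'M[C]_n, and
   a composite XY is C^(dX * dY), with basis vector (x, y) at mxtens_index. *)

Definition psdmx (C : numClosedFieldType) (n : nat) (A : 'M[C]_n) : Prop :=
  A \is hermsymmx /\ forall v : 'cV[C]_n, 0 <= (v^t* *m A *m v) 0 0.

Definition density (C : numClosedFieldType) (n : nat) (rho : 'M[C]_n) : Prop :=
  psdmx rho /\ \tr rho = 1.

(* Functional calculus A = P^-1 D P |-> P^-1 (sqrt D) P, meaningful for normal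
   A; on positive semidefinite A it is the positive square root, see
   sqrtmx_psd and sqrtmxK. *)
Definition sqrtmx (C : numClosedFieldType) (n : nat) (A : 'M[C]_n) : 'M[C]_n :=
  invmx (spectralmx A) *m diag_mx (map_mx sqrtC (spectral_diag A))
    *m spectralmx A.

(* Real-valued, although typed in C; the order of C compares real parts of
   numbers that have the same imaginary part. *)
Definition trace_norm (C : numClosedFieldType) (n : nat) (A : 'M[C]_n) : C :=
  \tr (sqrtmx (A^t* *m A)).

Definition maxmixed (C : numClosedFieldType) (n : nat) : 'M[C]_n :=
  (n%:R^-1)%:M.

(* U . rho = U rho U^-1, with U acting on the first factor of XY. *)
Definition act (C : numClosedFieldType) (m n : nat) (U : 'M[C]_m)
    (rho : 'M[C]_(m * n)) : 'M[C]_(m * n) :=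
  let V := tensmx U (1%:M : 'M[C]_n) in V *m rho *m invmx V.

(* Tr_X on XY *)
Definition ptrace1 (C : numClosedFieldType) (m n : nat)
    (rho : 'M[C]_(m * n)) : 'M[C]_n :=
  \matrix_(y, y') \sum_x rho (mxtens_index (x, y)) (mxtens_index (x, y')).

Definition index4 (n1 n2 n3 m : nat) (i : 'I_n1) (j : 'I_n2) (k : 'I_n3)
    (x : 'I_m) : 'I_(n1 * n2 * n3 * m) :=
  mxtens_index (mxtens_index (mxtens_index (i, j), k), x).

(* Tr_{C2 C3} on C1 C2 C3 X *)
Definition ptrace23 (C : numClosedFieldType) (n1 n2 n3 m : nat)
    (rho : 'M[C]_(n1 * n2 * n3 * m)) : 'M[C]_(n1 * m) :=
  \matrix_(a, b)
    let (i, x) := mxtens_unindex a in let (i', x') := mxtens_unindex b in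
    \sum_(j < n2) \sum_(k < n3) rho (index4 i j k x) (index4 i' j k x').

(* Tr_{C1 C3} on C1 C2 C3 X *)
Definition ptrace13 (C : numClosedFieldType) (n1 n2 n3 m : nat)
    (rho : 'M[C]_(n1 * n2 * n3 * m)) : 'M[C]_(n2 * m) :=
  \matrix_(a, b)
    let (j, x) := mxtens_unindex a in let (j', x') := mxtens_unindex b in
    \sum_(i < n1) \sum_(k < n3) rho (index4 i j k x) (index4 i j' k x').

Section SquareRoot.
Variables (C : numClosedFieldType) (n : nat) (A : 'M[C]_n).
Hypothesis A_psd : psdmx A.

Let P := spectralmx A.
Let D := spectral_diag A.

Fact psdmx_spectral : A = invmx P *m diag_mx D *m P.
Proof.
by case: A_psd => /hermitian_normalmx/orthomx_spectralP.
Qed.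

Fact psdmx_spectral_diag_ge0 i : 0 <= D 0 i.
Proof.
have PP : P *m invmx P = 1%:M by rewrite mulmxV // spectral_unit.
have := A_psd.2 (col i (invmx P)); suff -> : (col i (invmx P))^t* = row i P.
  rewrite {1}psdmx_spectral colE rowE.
  have -> (u : 'rV[C]_n) (w : 'cV[C]_n) :
    u *m P *m (invmx P *m diag_mx D *m P) *m (invmx P *m w)
      = u *m (P *m invmx P) *m diag_mx D *m (P *m invmx P) *m w.
    by rewrite !mulmxA.
  rewrite PP !mulmx1 -rowE row_diag_mx -scalemxAl mul_delta_mx !mxE !eqxx.
  by rewrite mulr1.
rewrite invmx_unitary ?spectral_unitarymx //.
by apply/rowP=> j; rewrite !mxE conjCK.
Qed.

Fact sqrtmxK : sqrtmx A *m sqrtmx A = A.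
Proof.
rewrite [RHS]psdmx_spectral /sqrtmx -/P -/D !mulmxA.
rewrite -(mulmxA _ P) mulmxV ?spectral_unit // mulmx1.
rewrite -(mulmxA _ (diag_mx _) (diag_mx _)) mulmx_diag; congr (_ *m diag_mx _ *m _).
by apply/rowP=> i; rewrite !mxE -expr2 sqrtCK.
Qed.

Fact sqrtmx_psd : psdmx (sqrtmx A).
Proof.
have PE : invmx P = P^t* by rewrite invmx_unitary ?spectral_unitarymx.
split.
  apply/is_hermitianmxP; rewrite expr0 scale1r /sqrtmx -/P -/D PE.
  rewrite !trmx_mul !map_mxM trmxCK mulmxA; congr (_ *m _ *m _).
  rewrite tr_diag_mx map_diag_mx; congr diag_mx.
  apply/rowP=> i; rewrite !mxE; apply/esym/CrealP.
  by rewrite ger0_real // sqrtC_ge0 psdmx_spectral_diag_ge0.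
move=> v; rewrite /sqrtmx -/P -/D PE.
have -> : v^t* *m (P^t* *m diag_mx (map_mx sqrtC D) *m P) *m v
    = (P *m v)^t* *m diag_mx (map_mx sqrtC D) *m (P *m v).
  by rewrite trmx_mul map_mxM !mulmxA.
rewrite mxE; apply: sumr_ge0 => i _; rewrite mul_mx_diag !mxE.
rewrite mulrAC mulr_ge0 ?sqrtC_ge0 ?psdmx_spectral_diag_ge0 //.
by rewrite mulrC mul_conjC_ge0.
Qed.

End SquareRoot.

(* Main.v *)
(**
The unitary is found by averaging over U = D P F D', where D, D' are diagonal
with entries in {1, i, -1, -i}, P is a permutation matrix and F is the Fourier
matrix, all of whose entries have modulus d_C^(-1/2). Let Y be a traceless
operator on C = C_1 R and W = (F D') Y (F D')^-1. In the average over D the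
off-diagonal entries of P W P^-1 contribute independently to
||Tr_R (U Y U^-1)||_2^2; averaging over P then leaves a combination of
||W||_2 = ||Y||_2 and of the norm of the diagonal of W; since F is flat, the
mean square of the latter over D' is at most ||Y||_2^2 / d_C. This gives
E ||Tr_R (U Y U^-1)||_2^2 <= ||Y||_2^2 / d_R, as for the Haar measure.
It is applied to the blocks of omega - pi_C (x) omega_F, and the trace norm is
bounded by ||M||_1^2 <= dim ||M||_2^2. If X(U) and Z(U) are the resulting
bounds for omega and psi, then E (beta X + alpha Z) <= 2 alpha beta, so a
single U gives X <= 2 alpha and Z <= 2 beta.
*)
Require Import Defs.
From mathcomp Require Import fingroup perm cyclic separable cyclotomic.
From mathcomp Require Import ring.
Import Order.TTheory GRing.Theory Num.Theory.
Local Open Scope ring_scope.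
Local Open Scope sesquilinear_scope.
Set Implicit Arguments.
Unset Strict Implicit.

(** * Uniform averages over a finite type *)

Section Mean.
Variables (C : numClosedFieldType) (T : finType).
Implicit Types f g : T -> C.

Definition mean f : C := #|T|%:R^-1 * \sum_t f t.

Lemma eq_mean f g : f =1 g -> mean f = mean g.
Proof. by move=> fg; congr (_ * _); apply: eq_bigr. Qed.

Lemma mean_sum (I : finType) (P : pred I) (F : I -> T -> C) :
  mean (fun t => \sum_(i | P i) F i t) = \sum_(i | P i) mean (F i).
Proof. by rewrite /mean exchange_big mulr_sumr. Qed.

Lemma meanZ c f : mean (fun t => c * f t) = c * mean f.
Proof. by rewrite /mean -mulr_sumr mulrCA. Qed.

Lemma meanD f g : mean (fun t => f t + g t) = mean f + mean g.
Proof. by rewrite /mean big_split mulrDr. Qed.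

Lemma mean_ge0 f : (forall t, 0 <= f t) -> 0 <= mean f.
Proof. by move=> f0; rewrite mulr_ge0 ?invr_ge0 ?ler0n ?sumr_ge0. Qed.

Hypothesis T_gt0 : (0 < #|T|)%N.

Lemma mean_const c : mean (fun=> c) = c.
Proof.
by rewrite /mean sumr_const -[c *+ _]mulr_natl mulKf // pnatr_eq0 -lt0n.
Qed.

Lemma mean_reindex f (h : T -> T) : injective h -> mean (f \o h) = mean f.
Proof. by move=> h_inj; rewrite /mean [in RHS](reindex_inj h_inj). Qed.

(** The order of [C] is only partial: nonnegativity of [f] and [c] makes them real, so that the
    failure of [f t <= c] means [c < f t], and summing these contradicts the bound on the mean. *)
Lemma mean_ex_le f c : (forall t, 0 <= f t) -> 0 <= c -> mean f <= c ->
  exists t, f t <= c.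
Proof.
move=> f0 c0 fc; have [/existsP//|/existsPn cf] := boolP [exists t, f t <= c].
suff : c < mean f by rewrite real_ltNge ?ger0_real ?mean_ge0 // fc.
rewrite -(mean_const c) /mean ltr_pM2l ?invr_gt0 ?ltr0n //.
have /card_gt0P[t0 _] := T_gt0.
apply: ltr_sum => [|t _]; first by apply/hasP; exists t0; rewrite ?mem_index_enum.
by rewrite real_ltNge ?ger0_real.
Qed.

End Mean.

(** * Random diagonal phases and their fourth-order correlations *)

Section Phases.
Variables (C : numClosedFieldType) (d : nat).
Implicit Types z : {ffun 'I_d -> 'I_4}.

Definition phase z : 'rV[C]_d := \row_i 'i ^+ z i.

Lemma expr4i : 'i ^+ 4 = 1 :> C.
Proof. by rewrite (exprM _ 2 2) sqrCi sqrrN expr1n. Qed.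

Lemma phase_conj z i : phase z 0 i * (phase z 0 i)^* = 1.
Proof. by rewrite !mxE -normCK normrX normCi !expr1n. Qed.

Lemma card_phases : (0 < #|{ffun 'I_d -> 'I_4}|)%N.
Proof. by rewrite card_ffun card_ord expn_gt0. Qed.

(** The addition is that of ['I_4], hence modulo 4, which matches ['i ^+ 4 = 1]. *)
Definition phase_shift (m : 'I_d) z : {ffun 'I_d -> 'I_4} :=
  [ffun j => z j + (j == m)%:R].

Lemma phase_shift_inj m : injective (phase_shift m).
Proof.
move=> z z' /ffunP zz'; apply/ffunP=> j; have := zz' j.
by rewrite !ffunE => /addIr.
Qed.

Lemma phase_shiftE m z j :
  phase (phase_shift m z) 0 j = (if j == m then 'i else 1) * phase z 0 j.
Proof.
rewrite !mxE ffunE; case: eqP => _; last by rewrite addr0 mul1r.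
by rewrite -exprS /= (expr_mod _ expr4i) addn1.
Qed.

(* A shift of one coordinate multiplies the summand by a constant other than 1. *)
Lemma mean_phase_orth i j k l : i != j -> (i, j) != (k, l) ->
  mean (fun z => phase z 0 i * (phase z 0 j)^*
                 * (phase z 0 k * (phase z 0 l)^*)^*) = 0.
Proof.
move=> ij ijkl; set f := fun z => _.
suff [m [c c1 fc]] : exists m, exists2 c, c != 1 & forall z, f (phase_shift m z) = c * f z.
  have := mean_reindex f (@phase_shift_inj m).
  rewrite (@eq_mean _ _ _ (fun z => c * f z)) // meanZ => /eqP.
  rewrite -subr_eq0 -{2}[mean f]mul1r -mulrBl mulf_eq0 subr_eq0 (negPf c1).
  by move/eqP.
have i1 : 'i != 1 :> C.
  apply: contra_neq (@oner_neq0 C) => i1; have := @sqrCi C.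
  rewrite i1 expr1n => /eqP; rewrite -addr_eq0 -(natrD _ 1 1) pnatr_eq0 //.
have n1 : -1 != 1 :> C by rewrite eq_sym -addr_eq0 -(natrD _ 1 1) pnatr_eq0.
(* If [i] differs from [k], shifting [i] yields the factor ['i], or ['i ^+ 2 = -1] when also
   [l = i]. Random signs would not do here: the pair [(k, l) = (j, i)] would survive. If [i = k],
   then [j] differs from [l], and shifting [j] yields the conjugate of ['i]. *)
have [ik|ik] := eqVneq i k; last first.
  exists i; exists (if l == i then -1 else 'i); first by case: ifP.
  move=> z; rewrite /f !phase_shiftE eqxx (eq_sym j) (negPf ij) (eq_sym k) (negPf ik).
  case: ifP => _; rewrite !mul1r ?rmorphM /= ?conjCK; last by ring.
  by rewrite -sqrCi; ring.
have jl : j != l by apply: contra_neq ijkl => ->; rewrite ik.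
exists j; exists (- 'i).
  by apply: contra_neq n1 => n1; rewrite -sqrCi -sqrrN n1 expr1n.
move=> z; rewrite /f !phase_shiftE eqxx (negPf ij) -ik (negPf ij) (eq_sym l) (negPf jl).
by rewrite !mul1r !rmorphM /= conjCi; ring.
Qed.

(** Expand the square: distinct [t] have distinct pairs [(u t, v t)], so their cross terms average
    to 0, while in the remaining terms the phases cancel. *)
Lemma mean_phase_sqr (T : finType) (P : pred T) (u v : T -> 'I_d) (c : T -> C) :
    (forall t, P t -> u t != v t) ->
    {in P &, injective (fun t => (u t, v t))} ->
  mean (fun z => `|\sum_(t | P t) c t * (phase z 0 (u t) * (phase z 0 (v t))^*)| ^+ 2)
    = \sum_(t | P t) `|c t| ^+ 2.
Proof.
move=> uv uv_inj.
under eq_mean => z.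
  rewrite normCK rmorph_sum mulr_suml.
  under eq_bigr do rewrite mulr_sumr.
  over.
rewrite mean_sum; apply: eq_bigr => t Pt.
rewrite mean_sum (bigD1 t) //= [X in _ + X]big1 ?addr0 => [|s /andP[Ps st]].
  rewrite -[RHS](mean_const card_phases); apply: eq_mean => z.
  rewrite !rmorphM /= conjCK normCK.
  transitivity (c t * (c t)^* * (phase z 0 (u t) * (phase z 0 (u t))^*)
     * (phase z 0 (v t) * (phase z 0 (v t))^*)); first by ring.
  by rewrite !phase_conj !mulr1.
under eq_mean do rewrite rmorphM /= mulrACA.
rewrite meanZ mean_phase_orth ?mulr0 ?uv //.
by apply: contra_neq st => /uv_inj->.
Qed.

End Phases.

(** * Averages over random permutations *)

Section Permutations.
Variables (C : numClosedFieldType) (d : nat).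

Lemma card_perms : (0 < #|{perm 'I_d}|)%N.
Proof. by apply/card_gt0P; exists 1%g. Qed.

(** The sum over [k] is invariant under every [s], so it may be averaged; left multiplication by the
    transposition of [i] and [k] identifies the mean of [f (s k)] with that of [f (s i)]. *)
Lemma mean_perm (f : 'I_d -> C) i :
  d%:R * mean (fun s : {perm 'I_d} => f (s i)) = \sum_k f k.
Proof.
rewrite -[RHS](mean_const card_perms).
rewrite [RHS](eq_mean (g := fun s : {perm _} => \sum_k f (s k))); last first.
  by move=> s; rewrite (reindex_inj (@perm_inj _ s)).
rewrite mean_sum -[X in X%:R * _ = _]card_ord mulr_natl -sumr_const; apply: eq_bigr => k _.
rewrite -(mean_reindex _ (mulgI (tperm i k))); apply: eq_mean => s /=.
by rewrite permM tpermL.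
Qed.

Lemma mean_perm2 (f : 'I_d -> 'I_d -> C) i j : i != j ->
  (d * d.-1)%:R * mean (fun s : {perm 'I_d} => f (s i) (s j))
    = \sum_k \sum_(l | l != k) f k l.
Proof.
move=> ij; rewrite -[RHS](mean_const card_perms).
rewrite [RHS](eq_mean (g := fun s : {perm _} =>
  \sum_k \sum_(l | l != k) f (s k) (s l))); last first.
  move=> s; rewrite (reindex_inj (@perm_inj _ s)); apply: eq_bigr => k _.
  rewrite (reindex_inj (@perm_inj _ s)); apply: eq_bigl => l.
  by rewrite (inj_eq perm_inj).
rewrite mean_sum natrM -mulrA -[X in X%:R * _ = _]card_ord mulr_natl -sumr_const.
apply: eq_bigr => k _; rewrite mean_sum.
have -> : d.-1 = #|[pred l | l != k]|.
  by have := cardC1 k; rewrite card_ord => <-.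
rewrite mulr_natl -sumr_const; apply: eq_big => // l /= lk.
(* This permutation sends [i] to [k] and [j] to [l]: its second factor fixes [k], because [l] and
   the image of [j] under the first both differ from [k]. *)
pose t := (tperm i k * tperm (tperm i k j) l)%g.
rewrite -(mean_reindex _ (mulgI t)); apply: eq_mean => s /=.
rewrite !permM tpermL tpermL tpermD //.
by rewrite -[X in _ != X](tpermL i k) (inj_eq perm_inj) eq_sym.
Qed.

End Permutations.

(** * Hilbert-Schmidt norm and unitary conjugation *)

Section Conjugation.
Variable C : numClosedFieldType.

Definition normsq m n (A : 'M[C]_(m, n)) : C := \sum_i \sum_j `|A i j| ^+ 2.

Definition diagsq n (A : 'M[C]_n) : C := \sum_i `|A i i| ^+ 2.

(** The adjoint replaces the inverse used in [act]; the two agree on unitaries, and the adjoint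
    gives entrywise formulas. *)
Definition conj_by n (V A : 'M[C]_n) : 'M[C]_n := V *m A *m V^t*.

Lemma normsq_tr m n (A : 'M[C]_(m, n)) : normsq A = \tr (A *m A^t*).
Proof.
apply: eq_bigr => i _; rewrite mxE; apply: eq_bigr => j _.
by rewrite !mxE normCK.
Qed.

Lemma normsq_ge0 m n (A : 'M[C]_(m, n)) : 0 <= normsq A.
Proof. by do 2!apply: sumr_ge0 => ? _; rewrite exprn_ge0. Qed.

Lemma diagsq_ge0 n (A : 'M[C]_n) : 0 <= diagsq A.
Proof. by apply: sumr_ge0 => ? _; rewrite exprn_ge0. Qed.

Lemma sum_offdiag n (A : 'M[C]_n) :
  \sum_i \sum_(j | j != i) `|A i j| ^+ 2 = normsq A - diagsq A.
Proof.
rewrite -sumrB; apply: eq_bigr => i _.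
by rewrite [in RHS](bigD1 i) //= addrC addrK.
Qed.

Lemma conj_byM n (V W A : 'M[C]_n) : conj_by (V *m W) A = conj_by V (conj_by W A).
Proof. by rewrite /conj_by trmx_mul map_mxM !mulmxA. Qed.

Lemma mxtrace_conj_by n (V A : 'M[C]_n) :
  V \is unitarymx -> \tr (conj_by V A) = \tr A.
Proof.
move=> Vu; rewrite /conj_by mxtrace_mulC mulmxA -invmx_unitary //.
by rewrite mulVmx ?unitarymx_unit // mul1mx.
Qed.

Lemma normsq_conj_by n (V A : 'M[C]_n) :
  V \is unitarymx -> normsq (conj_by V A) = normsq A.
Proof.
move=> Vu; rewrite !normsq_tr -[RHS](mxtrace_conj_by _ Vu) /conj_by.
rewrite !trmx_mul !map_mxM trmxCK !mulmxA -(mulmxA _ (V^t*) V).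
by rewrite -invmx_unitary // mulVmx ?unitarymx_unit // mulmx1.
Qed.

Lemma conj_by_diagE n (v : 'rV[C]_n) A i j :
  conj_by (diag_mx v) A i j = A i j * (v 0 i * (v 0 j)^*).
Proof.
rewrite /conj_by tr_diag_mx map_diag_mx mul_diag_mx mul_mx_diag !mxE.
by rewrite mulrAC mulrC.
Qed.

Lemma conj_by_permE n (s : {perm 'I_n}) A i j : conj_by (perm_mx s) A i j = A (s i) (s j).
Proof. by rewrite /conj_by tr_perm_mx map_perm_mx -row_permE -col_permE !mxE. Qed.

Lemma conj_byE n (V A : 'M[C]_n) i j :
  conj_by V A i j = \sum_k \sum_l A k l * (V i k * (V j l)^*).
Proof.
rewrite mxE; under eq_bigr do rewrite !mxE mulr_suml.
rewrite exchange_big; apply: eq_bigr => k _; apply: eq_bigr => l _.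
by ring.
Qed.

Lemma unitary_phase d z : diag_mx (@phase C d z) \is unitarymx.
Proof.
apply/unitarymxP; rewrite tr_diag_mx map_diag_mx mulmx_diag.
by apply/matrixP=> i j; rewrite !mxE -normCK normrX normCi !expr1n.
Qed.

Lemma unitary_perm d (s : {perm 'I_d}) : (perm_mx s : 'M[C]_d) \is unitarymx.
Proof. by apply/unitarymxP; rewrite tr_perm_mx map_perm_mx -perm_mxM mulgV perm_mx1. Qed.

End Conjugation.

(** * The discrete Fourier matrix *)

Section Fourier.
Variable C : numClosedFieldType.

(** In characteristic 0 the polynomial X^n - 1 is separable, so it has n distinct roots, and n
    distinct n-th roots of unity include a primitive one. *)
Lemma prim_root_exists n : (n > 0)%N -> exists z : C, n.-primitive_root z.
Proof.
move=> n_gt0; have [r Dp] := closed_field_poly_normal ('X^n - 1 : {poly C}).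
rewrite (monicP _) ?monicXnsubC // scale1r in Dp.
have rn1 : all n.-unity_root r by apply/allP=> z; rewrite -root_prod_XsubC -Dp.
have sz_r : (n < (size r).+1)%N by rewrite -(size_prod_XsubC r id) -Dp size_XnsubC.
have [|z _ pz] := hasP (has_prim_root n_gt0 rn1 _ sz_r); last by exists z.
by rewrite -separable_prod_XsubC -Dp separable_Xn_sub_1 // pnatr_eq0 -lt0n.
Qed.

Lemma flat_unitary_exists n : (n > 0)%N ->
  exists2 F : 'M[C]_n, F \is unitarymx & forall i j, `|F i j| ^+ 2 = n%:R^-1.
Proof.
move=> n_gt0; have [z pz] := prim_root_exists n_gt0.
have z1 : `|z| = 1.
  by apply/eqP; rewrite -(@pexpr_eq1 _ _ n) // -normrX (prim_expr_order pz) normr1.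
have zzc k : z ^+ k * (z ^+ k)^* = 1 by rewrite -normCK normrX z1 !expr1n.
pose F : 'M[C]_n := \matrix_(i, j) ((sqrtC n%:R)^-1 * z ^+ (i * j)).
exists F => [|i j]; last first.
  rewrite mxE normrM normfV normrX z1 expr1n mulr1 exprVn ger0_norm ?sqrtC_ge0 ?ler0n //.
  by rewrite sqrtCK.
apply/unitarymxP/matrixP=> i j; rewrite !mxE.
(* The inner product of rows [i] and [j] is a geometric sum in [w], an n-th root of unity that is 1
   only if [i = j]. *)
pose w := z ^+ i * (z ^+ j)^*.
rewrite (eq_bigr (fun k : 'I_n => n%:R^-1 * w ^+ k)); last first.
  move=> k _; rewrite !mxE rmorphM /= fmorphV /= !exprM /w exprMn rmorphXn /=.
  have -> : (sqrtC n%:R)^* = sqrtC n%:R :> C.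
    by apply/CrealP; rewrite ger0_real ?sqrtC_ge0 ?ler0n.
  by rewrite -[in RHS](sqrtCK n%:R) expr2 invfM; ring.
rewrite -mulr_sumr; have [ij|ij] := eqVneq i j.
  rewrite /w ij zzc; under eq_bigr do rewrite expr1n.
  by rewrite sumr_const card_ord mulVf // pnatr_eq0 -lt0n.
have w1 : w != 1.
  apply: contra_neq ij => w1; apply/val_inj/eqP=> /=.
  have : z ^+ i == z ^+ j by rewrite -[z ^+ j]mul1r -w1 /w -mulrA (mulrC (_^*)) zzc mulr1.
  by rewrite (eq_prim_root_expr pz) !modn_small.
have wn : w ^+ n = 1.
  rewrite exprMn -exprM -rmorphXn /= -exprM mulnC (mulnC j) !exprM.
  by rewrite (prim_expr_order pz) !expr1n rmorph1 mulr1.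
have /eqP := subrX1 w n; rewrite wn subrr eq_sym mulf_eq0 subr_eq0 (negPf w1) /=.
by move=> /eqP->; rewrite mulr0.
Qed.

End Fourier.

(** * Mean norm of a partial trace after mixing *)

Section PartialTrace.
Variables (C : numClosedFieldType) (d n : nat) (T : finType) (g : 'I_n * T -> 'I_d).

(* [g] splits the system as 'I_n (kept) times T (traced out), and [ptsq Z] is the
   squared Hilbert-Schmidt norm of the partial trace of Z over T. *)
Definition ptsq (Z : 'M[C]_d) : C :=
  \sum_a \sum_b `|\sum_r Z (g (a, r)) (g (b, r))| ^+ 2.

Lemma ptsq_ge0 Z : 0 <= ptsq Z.
Proof. by do 2!apply: sumr_ge0 => ? _; rewrite exprn_ge0. Qed.

Hypothesis g_inj : injective g.

Let cross (W : 'M[C]_d) a b : C := \sum_r `|W (g (a, r)) (g (b, r))| ^+ 2.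
Let block (W : 'M[C]_d) a : C := `|\sum_r W (g (a, r)) (g (a, r))| ^+ 2.

(** For [a = b] the phases cancel and the sum over [r] stays inside the modulus; for [a] and [b]
    distinct the entries decorrelate and only their squared moduli remain. *)
Lemma mean_phase_ptsq W :
  mean (fun z => ptsq (conj_by (diag_mx (phase C z)) W))
    = \sum_a (block W a + \sum_(b | b != a) cross W a b).
Proof.
rewrite mean_sum; apply: eq_bigr => a _; rewrite mean_sum (bigD1 a) //=.
congr (_ + _).
  rewrite -[RHS](mean_const (card_phases d)); apply: eq_mean => z.
  congr (`|_| ^+ 2); apply: eq_bigr => r _.
  by rewrite conj_by_diagE phase_conj mulr1.
apply: eq_bigr => b ba.
rewrite (eq_mean (g := fun z => `|\sum_r W (g (a, r)) (g (b, r))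
   * (phase C z 0 (g (a, r)) * (phase C z 0 (g (b, r)))^*)| ^+ 2)).
  rewrite (mean_phase_sqr (P := xpredT)) // => [r _|r s _ _ [/g_inj[->]]//].
  by rewrite (inj_eq g_inj) xpair_eqE eqxx andbT eq_sym.
by move=> z; congr (`|_| ^+ 2); apply: eq_bigr => r _; rewrite conj_by_diagE.
Qed.

Let t := #|T|.
Hypothesis dE : d = (n * t)%N.
Hypothesis d_gt0 : (0 < d)%N.

Let dR : d%:R != 0 :> C. Proof. by rewrite pnatr_eq0 -lt0n. Qed.

Lemma mean_perm2R (f : 'I_d -> 'I_d -> C) i j : i != j ->
  d%:R * (d%:R - 1) * mean (fun s : {perm 'I_d} => f (s i) (s j))
    = \sum_k \sum_(l | l != k) f k l.
Proof. by move=> /(mean_perm2 f) <-; rewrite natrM -subn1 natrB. Qed.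

Lemma mean_perm_cross W a b : b != a ->
  d%:R * (d%:R - 1) * mean (fun s => cross (conj_by (perm_mx s) W) a b)
    = t%:R * (normsq W - diagsq W).
Proof.
move=> ba; rewrite mean_sum mulr_sumr [RHS]mulr_natl -sumr_const; apply: eq_bigr => r _.
under eq_mean do rewrite conj_by_permE.
rewrite (mean_perm2R (fun k l => `|W k l| ^+ 2)) ?sum_offdiag //.
by rewrite (inj_eq g_inj) xpair_eqE eqxx andbT eq_sym.
Qed.

(** The expanded square has t terms with equal indices and t(t-1) with distinct ones. Scaled by
    d(d-1), each of the former averages to (d-1) [diagsq W] and, as the trace vanishes, each of the
    latter to - [diagsq W]; finally t(d-1) - t(t-1) = t(d-t). *)
Lemma mean_perm_block W a : \tr W = 0 ->
  d%:R * (d%:R - 1) * mean (fun s => block (conj_by (perm_mx s) W) a)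
    = t%:R * (d%:R - t%:R) * diagsq W.
Proof.
move=> trW.
have off : \sum_k \sum_(l | l != k) W k k * (W l l)^* = - diagsq W.
  rewrite -sumrN; apply: eq_bigr => k _; rewrite -mulr_sumr -rmorph_sum /=.
  have /eqP := trW; rewrite /mxtrace (bigD1 k) //= addrC addr_eq0 => /eqP->.
  by rewrite rmorphN mulrN normCK.
under eq_mean => s.
  rewrite /block normCK rmorph_sum mulr_suml.
  under eq_bigr => r _ do rewrite mulr_sumr.
  over.
rewrite mean_sum mulr_sumr -[RHS]mulrA [RHS]mulr_natl -sumr_const; apply: eq_bigr => r _.
rewrite mean_sum (bigD1 r) //= mulrDr.
under eq_mean do rewrite conj_by_permE.
rewrite mulrAC (mean_perm (fun k => W k k * (W k k)^*)).
have -> : \sum_k W k k * (W k k)^* = diagsq W.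
  by apply: eq_bigr => k _; rewrite normCK.
rewrite mulr_sumr (eq_bigr (fun=> - diagsq W)); last first.
  move=> s sr; under eq_mean do rewrite !conj_by_permE.
  rewrite (mean_perm2R (fun k l => W k k * (W l l)^*)) ?off //.
  by rewrite (inj_eq g_inj) xpair_eqE eqxx eq_sym.
rewrite sumr_const cardC1 -/t -[X in _ + X]mulr_natl -subn1 natrB.
  by ring.
by apply/card_gt0P; exists r.
Qed.

(** There are n blocks and n(n-1) cross terms; with d = n t their total has a factor d, which
    cancels. *)
Lemma mean_perm_phase_ptsq W : \tr W = 0 ->
  (d%:R - 1) * mean (fun s => mean (fun z =>
      ptsq (conj_by (diag_mx (phase C z)) (conj_by (perm_mx s) W))))
    = (n%:R - 1) * (normsq W + (t%:R - 1) * diagsq W).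
Proof.
move=> trW; under eq_mean do rewrite mean_phase_ptsq.
have n_gt0 : (0 < n)%N by move: d_gt0; rewrite dE muln_gt0 => /andP[].
apply: (mulfI dR); rewrite mulrA mean_sum mulr_sumr.
rewrite (eq_bigr (fun=> t%:R * (d%:R - t%:R) * diagsq W
    + (n%:R - 1) * (t%:R * (normsq W - diagsq W)))); last first.
  move=> a _; rewrite meanD mulrDr mean_perm_block //; congr (_ + _).
  rewrite mean_sum mulr_sumr (eq_bigr (fun=> t%:R * (normsq W - diagsq W))).
    by rewrite sumr_const cardC1 card_ord -[LHS]mulr_natl -subn1 natrB.
  by move=> b ba; rewrite mean_perm_cross.
have dnt : d%:R = n%:R * t%:R :> C by rewrite [in LHS]dE natrM.
by rewrite sumr_const card_ord -[LHS]mulr_natl dnt; ring.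
Qed.

Variable F : 'M[C]_d.
Hypothesis F_unitary : F \is unitarymx.
Hypothesis F_flat : forall i j, `|F i j| ^+ 2 = d%:R^-1.

(** In a diagonal entry of the conjugate, the terms with [k = l] add up to [\tr Y / d = 0] by
    flatness. The others are uncorrelated with weights d^-2, and there are d diagonal entries. *)
Lemma mean_phase_diagsq Y : \tr Y = 0 ->
  d%:R * mean (fun z => diagsq (conj_by F (conj_by (diag_mx (phase C z)) Y)))
    <= normsq Y.
Proof.
move=> trY; rewrite mean_sum.
rewrite (eq_bigr (fun=> d%:R^-1 ^+ 2 * (normsq Y - diagsq Y))) => [|i _].
  rewrite sumr_const card_ord (_ : _ * _ = normsq Y - diagsq Y) ?gerBl ?diagsq_ge0 //.
  by rewrite -[X in _ * X]mulr_natl; field.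
pose c (p : 'I_d * 'I_d) := Y p.1 p.2 * (F i p.1 * (F i p.2)^*).
rewrite (eq_mean (g := fun z => `|\sum_(p | p.1 != p.2) c p
   * (phase C z 0 p.1 * (phase C z 0 p.2)^*)| ^+ 2)) => [|z].
  rewrite mean_phase_sqr // => [|[? ?] [? ?] _ _ []/= -> ->//].
  rewrite -sum_offdiag pair_big_dep mulr_sumr /=.
  apply: eq_big => [[k l]|[k l] _] /=; first by rewrite eq_sym.
  by rewrite /c /= !normrM norm_conjC !exprMn !F_flat; ring.
rewrite conj_byE; under eq_bigr => k _ do rewrite (bigD1 k) //=.
rewrite big_split /= [X in X + _](_ : _ = 0) ?add0r.
  rewrite pair_big_dep /=; congr (`|_| ^+ 2).
  apply: eq_big => [[k l]|[k l] _] /=; first by rewrite eq_sym.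
  by rewrite conj_by_diagE /c /=; ring.
transitivity (\sum_k d%:R^-1 * Y k k); last by rewrite -mulr_sumr -/(\tr Y) trY mulr0.
apply: eq_bigr => k _.
by rewrite conj_by_diagE phase_conj mulr1 -normCK F_flat mulrC.
Qed.

Definition mixing z (s : {perm 'I_d}) z' : 'M[C]_d :=
  diag_mx (phase C z) *m (perm_mx s *m (F *m diag_mx (phase C z'))).

Lemma mixing_unitary z s z' : mixing z s z' \is unitarymx.
Proof. by rewrite !mul_unitarymx ?unitary_phase ?unitary_perm. Qed.

Lemma mean_mixing_ptsq Y : \tr Y = 0 ->
  t%:R * mean (fun z' => mean (fun s => mean (fun z =>
    ptsq (conj_by (mixing z s z') Y)))) <= normsq Y.
Proof.
move=> trY; pose W z' := conj_by F (conj_by (diag_mx (phase C z')) Y).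
set M := mean _.
(* The permutation averages carry a factor d - 1, which can be cancelled only for d > 1; for d = 1 a
   traceless [Y] is zero. *)
have [d1|d_gt1] := leqP d 1.
  have Y0 : Y = 0.
    have all0 (i j : 'I_d) : i = j.
      apply/val_inj => /=; have := leq_trans (ltn_ord i) d1.
      by have := leq_trans (ltn_ord j) d1; rewrite !ltnS !leqn0 => /eqP-> /eqP->.
    apply/matrixP=> i j; rewrite !mxE -trY /mxtrace (bigD1 i) //= big1 ?addr0.
      by rewrite (all0 j i).
    by move=> k /eqP[]; apply: all0.
  rewrite (_ : M = mean (fun _ : {ffun 'I_d -> 'I_4} => mean (fun _ : {perm 'I_d} =>
     mean (fun _ : {ffun 'I_d -> 'I_4} => 0)))); last first.
    apply: eq_mean => z'; apply: eq_mean => s; apply: eq_mean => z.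
    rewrite Y0 /conj_by mulmx0 mul0mx /ptsq big1 // => a _; rewrite big1 // => b _.
    by rewrite big1 ?normr0 ?expr0n // => r _; rewrite mxE.
  by rewrite !mean_const ?card_phases ?card_perms // mulr0 normsq_ge0.
have dR1 : 0 < d%:R - 1 :> C by rewrite subr_gt0 ltr1n.
have n_gt0 : (0 < n)%N by move: d_gt0; rewrite dE muln_gt0 => /andP[].
have t_gt0 : (0 < t)%N by move: d_gt0; rewrite dE muln_gt0 => /andP[].
have dnt : d%:R = n%:R * t%:R :> C by rewrite [in LHS]dE natrM.
have ME : (d%:R - 1) * M
    = (n%:R - 1) * (normsq Y + (t%:R - 1) * mean (fun z' => diagsq (W z'))).
  rewrite -meanZ -(meanZ (t%:R - 1)) -[in RHS](mean_const (card_phases d) (normsq Y)).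
  rewrite -meanD -meanZ; apply: eq_mean => z'.
  have trW : \tr (W z') = 0 by rewrite !mxtrace_conj_by ?unitary_phase.
  rewrite -[normsq Y](normsq_conj_by _ (unitary_phase C z')).
  rewrite -(normsq_conj_by _ F_unitary) -mean_perm_phase_ptsq //; congr (_ * _).
  by apply: eq_mean => s; apply: eq_mean => z; rewrite /mixing !conj_byM.
have dpos : 0 < d%:R :> C by rewrite ltr0n.
rewrite -(ler_pM2l (mulr_gt0 dpos dR1)).
have n1 : 0 <= n%:R - 1 :> C by rewrite subr_ge0 ler1n.
have t1 : 0 <= t%:R - 1 :> C by rewrite subr_ge0 ler1n.
have -> : d%:R * (d%:R - 1) * (t%:R * M) = d%:R * t%:R * ((d%:R - 1) * M) by ring.
rewrite ME.
apply: (@le_trans _ _ (t%:R * (n%:R - 1) * (d%:R * normsq Y + (t%:R - 1) * normsq Y))).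
  set m := mean _.
  rewrite [leLHS](_ : _ = t%:R * (n%:R - 1)
    * (d%:R * normsq Y + (t%:R - 1) * (d%:R * m))); last by ring.
  rewrite ler_wpM2l ?mulr_ge0 ?ler0n // lerD2l ler_wpM2l //.
  exact: mean_phase_diagsq.
(* With d = n t, the two sides differ by exactly t(t-1) times [normsq Y]. *)
rewrite -subr_ge0 dnt.
rewrite [leRHS](_ : _ = t%:R * (t%:R - 1) * normsq Y); last by ring.
by rewrite !mulr_ge0 ?normsq_ge0 ?ler0n.
Qed.

End PartialTrace.

(** * Trace norm against Hilbert-Schmidt norm *)

Section TraceNorm.
Variable C : numClosedFieldType.

(** Cauchy-Schwarz, from the nonnegativity of the sum of all (a_i - a_j)^2. *)
Lemma sqr_sum_le (I : finType) (a : I -> C) : (forall i, a i \is Num.real) ->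
  (\sum_i a i) ^+ 2 <= #|I|%:R * \sum_i a i ^+ 2.
Proof.
move=> a_real.
have : 0 <= \sum_i \sum_j (a i - a j) ^+ 2.
  by do 2!apply: sumr_ge0 => ? _; rewrite -realEsqr rpredB.
rewrite (_ : \sum_i _ = 2 * (#|I|%:R * \sum_i a i ^+ 2 - (\sum_i a i) ^+ 2)).
  by rewrite pmulr_rge0 ?ltr0n // subr_ge0.
transitivity (\sum_i \sum_j (a i ^+ 2 + a j ^+ 2 - 2 * (a i * a j))).
  by do 2!apply: eq_bigr => ? _; ring.
under eq_bigr => i _.
  rewrite sumrB big_split /= sumr_const -mulr_sumr -mulr_sumr.
  rewrite -[X in X + _ - _]mulr_natl.
  over.
rewrite sumrB big_split /= sumr_const -!mulr_sumr -mulr_suml.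
by rewrite -[X in _ + X - _]mulr_natl; ring.
Qed.

Lemma gram_psd n (A : 'M[C]_n) : psdmx (A^t* *m A).
Proof.
split; first by apply/is_hermitianmxP; rewrite expr0 scale1r trmx_mul map_mxM trmxCK.
move=> v; have -> : v^t* *m (A^t* *m A) *m v = (A *m v)^t* *m (A *m v).
  by rewrite trmx_mul map_mxM !mulmxA.
rewrite mxE; apply: sumr_ge0 => i _.
by rewrite !mxE mulrC mul_conjC_ge0.
Qed.

(** The trace norm is the sum of the n singular values and [normsq] the sum of their squares. *)
Lemma trace_norm_sqr_le n (A : 'M[C]_n) : trace_norm A ^+ 2 <= n%:R * normsq A.
Proof.
have psd := gram_psd A; set B := A^t* *m A in psd *.
have sp : spectralmx B \in unitmx by apply: spectral_unit.
have -> : trace_norm A = \sum_i sqrtC (spectral_diag B 0 i).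
  rewrite /trace_norm /sqrtmx -/B mxtrace_mulC mulmxA mulmxV // mul1mx mxtrace_diag.
  by apply: eq_bigr => i _; rewrite mxE.
have -> : normsq A = \sum_i sqrtC (spectral_diag B 0 i) ^+ 2.
  rewrite normsq_tr mxtrace_mulC -/B {1}(psdmx_spectral psd).
  rewrite mxtrace_mulC mulmxA mulmxV // mul1mx mxtrace_diag.
  by apply: eq_bigr => i _; rewrite sqrtCK.
rewrite -[X in X%:R]card_ord; apply: sqr_sum_le => i.
by rewrite ger0_real // sqrtC_ge0 psdmx_spectral_diag_ge0.
Qed.

End TraceNorm.

(** * Blocks over the reference system and their traceless parts *)

Section Blocks.
Variable C : numClosedFieldType.

Lemma sum_mxtens (m n : nat) (F : 'I_(m * n) -> C) :
  \sum_p F p = \sum_i \sum_x F (mxtens_index (i, x)).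
Proof.
rewrite pair_big /= (reindex (@mxtens_index m n)) /=; last first.
  by exists (@mxtens_unindex m n) => ? _; rewrite (mxtens_indexK, mxtens_unindexK).
by apply: eq_bigr => -[].
Qed.

(** A unitary on the first factor conjugates each block separately, which reduces a bipartite
    operator to operators on the first factor alone. *)
Definition opblock (m f : nat) (A : 'M[C]_(m * f)) (x y : 'I_f) : 'M[C]_m :=
  \matrix_(i, j) A (mxtens_index (i, x)) (mxtens_index (j, y)).

Lemma normsq_opblock (m f : nat) (A : 'M[C]_(m * f)) :
  normsq A = \sum_x \sum_y normsq (opblock A x y).
Proof.
rewrite /normsq sum_mxtens exchange_big; apply: eq_bigr => x _.
rewrite [RHS]exchange_big /=; apply: eq_bigr => i _.
rewrite sum_mxtens exchange_big; apply: eq_bigr => y _.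
by apply: eq_bigr => j _; rewrite mxE.
Qed.

Lemma tensmx11 (m n : nat) : tensmx (1%:M : 'M[C]_m) (1%:M : 'M[C]_n) = 1%:M.
Proof.
apply/matrixP=> p q; case: (mxtens_indexP p) => i x; case: (mxtens_indexP q) => j y.
rewrite tensmxE !mxE (inj_eq (can_inj (@mxtens_indexK m n))) xpair_eqE.
by rewrite -natrM mulnb.
Qed.

Lemma opblock_act (m f : nat) (U : 'M[C]_m) (A : 'M[C]_(m * f)) x y :
  U \is unitarymx -> opblock (act U A) x y = conj_by U (opblock A x y).
Proof.
move=> Uu; set V := tensmx U (1%:M : 'M[C]_f).
have V_adj : V^t* = tensmx (U^t*) 1%:M.
  by rewrite trmx_tens map_mxT trmx1 map_mx1.
have Vu : V \is unitarymx.
  by apply/unitarymxP; rewrite V_adj tensmx_mul (unitarymxP _) // mulmx1 tensmx11.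
apply/matrixP=> i j; rewrite [LHS]mxE /act -/V invmx_unitary // V_adj.
rewrite [LHS]mxE [RHS]mxE sum_mxtens; apply: eq_bigr => l _.
rewrite (bigD1 y) //= [X in _ + X]big1 ?addr0 => [|w wy]; last first.
  by rewrite tensmxE !mxE (negPf wy) !mulr0.
rewrite tensmxE !mxE eqxx mulr1 sum_mxtens; congr (_ * _); apply: eq_bigr => k _.
rewrite (bigD1 x) //= [X in _ + X]big1 ?addr0 => [|w wx]; last first.
  by rewrite tensmxE !mxE eq_sym (negPf wx) mulr0 mul0r.
by rewrite tensmxE !mxE eqxx mulr1.
Qed.

(** Applied to the blocks of A, this gives the blocks of A minus the maximally mixed state tensored
    with the partial trace of A. *)
Definition centered n (A : 'M[C]_n) : 'M[C]_n := A - (\tr A / n%:R)%:M.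

Lemma mxtrace_centered n (A : 'M[C]_n) : (0 < n)%N -> \tr (centered A) = 0.
Proof.
move=> n_gt0; rewrite mxtraceD raddfN /= mxtrace_scalar -[_ *+ n]mulr_natr.
by rewrite divfK ?subrr // pnatr_eq0 -lt0n.
Qed.

Lemma normsq_centered n (A : 'M[C]_n) : (0 < n)%N ->
  normsq (centered A) <= normsq A.
Proof.
move=> n_gt0; set c := \tr A / n%:R.
have nR : n%:R != 0 :> C by rewrite pnatr_eq0 -lt0n.
have trA : \tr A = n%:R * c by rewrite /c mulrC divfK.
have trAc : \sum_i (A i i)^* = n%:R * c^*.
  by rewrite -rmorph_sum /= -/(\tr A) trA rmorphM /= conjC_nat.
(* Pythagoras: the traceless part is orthogonal to the scalar matrices. *)
have -> : normsq (centered A) = normsq A - n%:R * `|c| ^+ 2.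
  rewrite -(subrK (diagsq A) (normsq A)) -(subrK (diagsq (centered A)) (normsq _)).
  rewrite -!sum_offdiag -[RHS]addrA; congr (_ + _).
    apply: eq_bigr => i _; apply: eq_bigr => j ij.
    by rewrite !mxE eq_sym (negPf ij) subr0.
  transitivity (\sum_i (`|A i i| ^+ 2 - c^* * A i i - c * (A i i)^* + c * c^*)).
    apply: eq_bigr => i _; rewrite !mxE eqxx mulr1n !normCK rmorphB /= -/c; ring.
  rewrite big_split /= !sumrB -!mulr_sumr trAc -/(\tr A) trA sumr_const card_ord.
  by rewrite -[c^* *+ n]mulr_natl normCK -/(diagsq A); ring.
by rewrite gerBl mulr_ge0 ?ler0n ?exprn_ge0.
Qed.

End Blocks.

(** * Expectation over the random unitary *)

Section MixingMean.
Variables (C : numClosedFieldType) (d : nat) (F : 'M[C]_d).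
Implicit Types h : 'M[C]_d -> C.

Definition mixing_mean h : C :=
  mean (fun z' => mean (fun s => mean (fun z => h (mixing F z s z')))).

Lemma mixing_meanD h k :
  mixing_mean (fun U => h U + k U) = mixing_mean h + mixing_mean k.
Proof.
rewrite -meanD; apply: eq_mean => z'; rewrite -meanD; apply: eq_mean => s.
by rewrite -meanD.
Qed.

Lemma mixing_meanZ c h : mixing_mean (fun U => c * h U) = c * mixing_mean h.
Proof.
rewrite -meanZ; apply: eq_mean => z'; rewrite -meanZ; apply: eq_mean => s.
by rewrite -meanZ.
Qed.

Lemma mixing_mean_sum (I : finType) (H : I -> 'M[C]_d -> C) :
  mixing_mean (fun U => \sum_i H i U) = \sum_i mixing_mean (H i).
Proof.
rewrite -mean_sum; apply: eq_mean => z'; rewrite -mean_sum; apply: eq_mean => s.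
by rewrite -mean_sum.
Qed.

(** The three nested means are unwound from the outside, fixing [z'], then [s], then [z]. *)
Lemma mixing_mean_ex_le h c : F \is unitarymx -> (forall U, 0 <= h U) ->
  0 <= c -> mixing_mean h <= c -> exists2 U, U \is unitarymx & h U <= c.
Proof.
move=> Fu h0 c0 /(mean_ex_le (card_phases d)) [||z']//.
  by move=> z'; do 2!apply: mean_ge0 => ?.
move=> /(mean_ex_le (card_perms d)) [||s]//; first by move=> s; apply: mean_ge0.
move=> /(mean_ex_le (card_phases d)) [||z le]//.
by exists (mixing F z s z'); rewrite ?mixing_unitary.
Qed.

End MixingMean.

(** * Decoupling bound for one bipartite operator *)

Section Decoupling.
Variables (C : numClosedFieldType) (D n f : nat) (T : finType).
Variable g : 'I_n * T -> 'I_D.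
Hypothesis g_inj : injective g.
Hypothesis DE : D = (n * #|T|)%N.
Hypothesis D_gt0 : (0 < D)%N.

(** For unitary [U] this is the squared Hilbert-Schmidt distance of the partial trace of [act U A]
    over [T] from the decoupled product. *)
Definition deviation (A : 'M[C]_(D * f)) (U : 'M[C]_D) : C :=
  \sum_x \sum_y ptsq g (conj_by U (centered (opblock A x y))).

Lemma deviation_ge0 A U : 0 <= deviation A U.
Proof. by do 2!apply: sumr_ge0 => ? _; apply: ptsq_ge0. Qed.

Lemma mixing_mean_deviation (F : 'M[C]_D) A : F \is unitarymx ->
    (forall i j, `|F i j| ^+ 2 = D%:R^-1) ->
  #|T|%:R * mixing_mean F (deviation A) <= normsq A.
Proof.
move=> Fu Fflat; rewrite mixing_mean_sum mulr_sumr normsq_opblock.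
apply: ler_sum => x _; rewrite mixing_mean_sum mulr_sumr; apply: ler_sum => y _.
apply: le_trans (normsq_centered _ D_gt0).
by apply: mean_mixing_ptsq; rewrite ?mxtrace_centered.
Qed.

(** [M] is specified by its entries so that [ptrace23] and [ptrace13] are both covered, through two
    choices of [g]. *)
Lemma trace_norm_deviation A U (M : 'M[C]_(n * f)) : U \is unitarymx ->
    (forall a b x y, M (mxtens_index (a, x)) (mxtens_index (b, y)) =
       \sum_r act U A (mxtens_index (g (a, r), x)) (mxtens_index (g (b, r), y))
       - tensmx (maxmixed C n) (ptrace1 A) (mxtens_index (a, x)) (mxtens_index (b, y))) ->
  trace_norm M ^+ 2 <= (n * f)%:R * deviation A U.
Proof.
move=> Uu ME; apply: le_trans (trace_norm_sqr_le M) _.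
rewrite normsq_opblock ler_wpM2l ?ler0n //.
apply: ler_sum => x _; apply: ler_sum => y _.
rewrite le_eqVlt; apply/orP; left; apply/eqP.
apply: eq_bigr => a _; apply: eq_bigr => b _; congr (`|_| ^+ 2).
rewrite mxE ME tensmxE.
have -> : conj_by U (centered (opblock A x y))
    = opblock (act U A) x y - (\tr (opblock A x y) / D%:R)%:M.
  rewrite opblock_act // /conj_by /centered mulmxBr mulmxBl; congr (_ - _).
  by rewrite mul_mx_scalar -scalemxAl (unitarymxP _) // scalemx1.
transitivity (\sum_r (act U A (mxtens_index (g (a, r), x)) (mxtens_index (g (b, r), y))
    - \tr (opblock A x y) / D%:R *+ (a == b))); last first.
  apply: eq_bigr => r _; rewrite !mxE (inj_eq g_inj) xpair_eqE eqxx andbT //.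
rewrite sumrB sumr_const; congr (_ - _).
have -> : \tr (opblock A x y) = ptrace1 A x y.
  by rewrite [RHS]mxE; apply: eq_bigr => k _; rewrite mxE.
(* Each of the [#|T|] traced indices removes trace / D, and [#|T|] / D = 1 / n is the diagonal entry
   of [maxmixed]. *)
have : D%:R = n%:R * #|T|%:R :> C by rewrite [in LHS]DE natrM.
have /andP[n0 t0] : (0 < n)%N && (0 < #|T|)%N by rewrite -muln_gt0 -DE.
move=> ->.
rewrite mxE -[RHS]mulr_natr; case: (a == b); last by rewrite !mulr0n !mul0r.
by rewrite !mulr1n; field; rewrite !pnatr_eq0 -!lt0n n0 t0.
Qed.

End Decoupling.

(** * Purity of density operators and the two splittings of C *)

Lemma density_dim_gt0 (C : numClosedFieldType) n (rho : 'M[C]_n) :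
  density rho -> (0 < n)%N.
Proof.
case: n rho => // rho [_ /eqP]; rewrite /mxtrace big_ord0 eq_sym.
by rewrite (negPf (@oner_neq0 C)).
Qed.

Lemma density_normsq (C : numClosedFieldType) n (rho : 'M[C]_n) :
  density rho -> \tr (rho *m rho) = normsq rho.
Proof.
case=> -[/is_hermitianmxP rhoH _] _; rewrite normsq_tr.
by move: rhoH; rewrite expr0 scale1r => <-.
Qed.

Lemma density_normsq_gt0 (C : numClosedFieldType) n (rho : 'M[C]_n) :
  density rho -> 0 < normsq rho.
Proof.
move=> [_ tr1]; rewrite lt0r normsq_ge0 andbT.
apply: contra_eqN tr1 => /eqP; rewrite /normsq.
move=> /psumr_eq0P rho0; rewrite /mxtrace big1 ?(eq_sym 0) ?oner_neq0 // => i _.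
have /psumr_eq0P/(_ i isT)/eqP : \sum_j `|rho i j| ^+ 2 = 0.
  by apply: rho0 => // k _; apply: sumr_ge0 => j _; rewrite exprn_ge0.
by rewrite sqrf_eq0 normr_eq0 => /(_ _)/eqP->// j _; rewrite exprn_ge0.
Qed.

Lemma mxtens_index_inj (m n : nat) (i i' : 'I_m) (x x' : 'I_n) :
  mxtens_index (i, x) = mxtens_index (i', x') -> i = i' /\ x = x'.
Proof. by move=> /(congr1 (@mxtens_unindex m n)); rewrite !mxtens_indexK => -[]. Qed.

Lemma index23_inj (d1 d2 d3 : nat) : injective (fun p : 'I_d1 * ('I_d2 * 'I_d3) =>
  mxtens_index (mxtens_index (p.1, p.2.1), p.2.2)).
Proof.
by move=> [i [j k]] [i' [j' k']] /= /mxtens_index_inj[/mxtens_index_inj[-> ->] ->].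
Qed.

Lemma index13_inj (d1 d2 d3 : nat) : injective (fun p : 'I_d2 * ('I_d1 * 'I_d3) =>
  mxtens_index (mxtens_index (p.2.1, p.1), p.2.2)).
Proof.
by move=> [j [i k]] [j' [i' k']] /= /mxtens_index_inj[/mxtens_index_inj[-> ->] ->].
Qed.

(** * Choice of a common unitary *)

Unset Implicit Arguments.

Theorem theorem2 (R : realType) (d1 d2 d3 dE dF : nat)
    (omega : 'M[R[i]]_(d1 * d2 * d3 * dF))
    (psi : 'M[R[i]]_(d1 * d2 * d3 * dE))
    (omega_density : density omega) (psi_density : density psi) :
  let alpha : R[i] :=
    (d1 * d2 * d3)%:R * dF%:R * \tr (omega *m omega) / (d2 * d3)%:R ^+ 2 in
  let beta : R[i] :=
    (d1 * d2 * d3)%:R * dE%:R * \tr (psi *m psi) / (d1 * d3)%:R ^+ 2 in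
  exists U : 'M[R[i]]_(d1 * d2 * d3),
    [/\ U \is unitarymx,
        trace_norm (ptrace23 (act U omega)
                    - tensmx (maxmixed _ d1) (ptrace1 omega)) ^+ 2
          <= 2 * alpha
      & trace_norm (ptrace13 (act U psi)
                    - tensmx (maxmixed _ d2) (ptrace1 psi)) ^+ 2
          <= 2 * beta].
Proof.
move=> alpha beta.
have := density_dim_gt0 omega_density; rewrite muln_gt0 => /andP[D_gt0 dF_gt0].
have := density_dim_gt0 psi_density; rewrite muln_gt0 => /andP[_ dE_gt0].
have : (0 < d1 * d2 * d3)%N by [].
rewrite !muln_gt0 => /andP[/andP[d1_gt0 d2_gt0] d3_gt0].
have natr_pos k : (0 < k)%N -> 0 < k%:R :> R[i] by rewrite ltr0n.
have alpha_gt0 : 0 < alpha.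
  by rewrite /alpha density_normsq // !mulr_gt0 ?invr_gt0 ?exprn_gt0 ?natr_pos
    ?muln_gt0 ?density_normsq_gt0 ?d1_gt0 ?d2_gt0.
have beta_gt0 : 0 < beta.
  by rewrite /beta density_normsq // !mulr_gt0 ?invr_gt0 ?exprn_gt0 ?natr_pos
    ?muln_gt0 ?density_normsq_gt0 ?d1_gt0 ?d2_gt0.
have [F Fu Fflat] := flat_unitary_exists (R[i]) D_gt0.
have D23 : (d1 * d2 * d3 = d1 * #|{: 'I_d2 * 'I_d3}|)%N.
  by rewrite card_prod !card_ord mulnA.
have D13 : (d1 * d2 * d3 = d2 * #|{: 'I_d1 * 'I_d3}|)%N.
  by rewrite card_prod !card_ord mulnA (mulnC d2).
have := mixing_mean_deviation (@index23_inj d1 d2 d3) D23 D_gt0 omega Fu Fflat.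
have := mixing_mean_deviation (@index13_inj d1 d2 d3) D13 D_gt0 psi Fu Fflat.
set Xpsi := deviation _ psi; set Xomega := deviation _ omega => mean_psi mean_omega.
(* Each bound is weighted by the target of the other, so both summands have mean at most alpha
   beta. *)
pose h U := beta * ((d1 * dF)%:R * Xomega U) + alpha * ((d2 * dE)%:R * Xpsi U).
have Xomega0 U : 0 <= (d1 * dF)%:R * Xomega U.
  by rewrite mulr_ge0 ?ler0n ?deviation_ge0.
have Xpsi0 U : 0 <= (d2 * dE)%:R * Xpsi U.
  by rewrite mulr_ge0 ?ler0n ?deviation_ge0.
have mean_h : mixing_mean F h <= 2 * (alpha * beta).
  rewrite mixing_meanD !mixing_meanZ.
  rewrite (_ : 2 * _ = beta * alpha + alpha * beta); last by ring.
  (* As d_C / d_{C2C3}^2 = d_{C1} / d_{C2C3}, alpha is d_{C1} d_F times the bound on the mean of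
     [Xomega]; similarly for beta. *)
  apply: lerD; rewrite ler_pM2l //.
    rewrite /alpha density_normsq // ler_pdivlMr ?exprn_gt0 ?natr_pos ?muln_gt0 ?d2_gt0 //.
    rewrite card_prod !card_ord in mean_omega.
    rewrite [leLHS](_ : _ = (d1 * d2 * d3)%:R * dF%:R
       * ((d2 * d3)%:R * mixing_mean F Xomega)); last by rewrite !natrM; ring.
    by rewrite ler_wpM2l ?mulr_ge0 ?ler0n.
  rewrite /beta density_normsq // ler_pdivlMr ?exprn_gt0 ?natr_pos ?muln_gt0 ?d1_gt0 //.
  rewrite card_prod !card_ord in mean_psi.
  rewrite [leLHS](_ : _ = (d1 * d2 * d3)%:R * dE%:R
     * ((d1 * d3)%:R * mixing_mean F Xpsi)); last by rewrite !natrM; ring.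
  by rewrite ler_wpM2l ?mulr_ge0 ?ler0n.
have [||U Uu hU] := mixing_mean_ex_le Fu _ _ mean_h.
- by move=> U; rewrite addr_ge0 // mulr_ge0 // ltW.
- exact: (mulr_ge0 (ler0n _ 2) (ltW (mulr_gt0 alpha_gt0 beta_gt0))).
exists U; split=> //.
- apply: (@le_trans _ _ ((d1 * dF)%:R * Xomega U)).
    apply: (trace_norm_deviation (@index23_inj d1 d2 d3) D23 D_gt0 Uu) => a b x y.
    rewrite [LHS]mxE; congr (_ + _); last by rewrite mxE.
    by rewrite mxE !mxtens_indexK pair_big.
  (* After multiplication by beta > 0 the left side is a summand of [h U]; the other summand is
     nonnegative and is dropped. *)
  rewrite -(ler_pM2l beta_gt0); apply: le_trans (_ : h U <= _).
    by rewrite lerDl mulr_ge0 // ltW.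
  by apply: le_trans hU _; rewrite le_eqVlt; apply/orP; left; apply/eqP; ring.
- apply: (@le_trans _ _ ((d2 * dE)%:R * Xpsi U)).
    apply: (trace_norm_deviation (@index13_inj d1 d2 d3) D13 D_gt0 Uu) => a b x y.
    rewrite [LHS]mxE; congr (_ + _); last by rewrite mxE.
    by rewrite mxE !mxtens_indexK pair_big.
  rewrite -(ler_pM2l alpha_gt0); apply: le_trans (_ : h U <= _).
    by rewrite lerDr mulr_ge0 // ltW.
  by apply: le_trans hU _; rewrite le_eqVlt; apply/orP; left; apply/eqP; ring.
Qed.
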